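(* Consider the following interpretation. Each type is a set; for lists of types $t=A_1\cdots A_n$ and $t'=B_1\cdots B_m$, the diagrams $S:t\to t'$ are the constructive functions $A_1\cdots A_n\stackrel{c}{\longrightarrow}B_1\cdots B_m$. The constants are interpreted as: $\mathsf{Id}(t)$ is the identity function; $\mathsf{Split}(t)(x)=(x,x)$; $\mathsf{Sink}(t)(x)$ is the empty tuple; $\mathsf{Switch}(t,t')(x,x')=(x',x)$. Serial composition is $S;T=T\circ S$; parallel composition is $(S\,\|\,T)(x,y)=(S(x),T(y))$; and for $f:A\cdot B\stackrel{c}{\longrightarrow}A\cdot B'$ with $A$ a single type, $\mathsf{feedback}(f):B\stackrel{c}{\longrightarrow}B'$ is $\mathsf{feedback}(f)(y)=f_2(\mu x.\,f_1(x,y),\,y)$, where $f_1,f_2$ are the $A$- and $B'$-components of $f$ and $\mu x.\,f_1(x,y)$ is the least fixpoint of $x\mapsto f_1(x,y)$. Then this interpretation satisfies all of the following axioms (for all well-typed diagrams, all lists of types $t,t',t'',t_1,\dots,s,s',s''$, and all single types $a,b$; $\|$ binds more tightly than $;$, and $\mathsf{feedback}^2$ denotes applying $\mathsf{feedback}$ twice): (1) if $S:t\to t'$ then $\mathsf{Id}(t);S=S;\mathsf{Id}(t')=S$; (2) if $S:t_1\to t_2$, $T:t_2\to t_3$, $R:t_3\to t_4$ then $S;(T;R)=(S;T);R$; (3) $\mathsf{Id}(\epsilon)\,\|\,S=S\,\|\,\mathsf{Id}(\epsilon)=S$; (4) $S\,\|\,(T\,\|\,R)=(S\,\|\,T)\,\|\,R$;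 (5) if $S:s\to s'$, $S':s'\to s''$, $T:t\to t'$, $T':t'\to t''$ then $(S\,\|\,T);(S'\,\|\,T')=(S;S')\,\|\,(T;T')$; (6) $\mathsf{Split}(t);\mathsf{Sink}(t)\,\|\,\mathsf{Id}(t)=\mathsf{Id}(t)$; (7) $\mathsf{Split}(t);\mathsf{Switch}(t,t)=\mathsf{Split}(t)$; (8) $\mathsf{Split}(t);\mathsf{Id}(t)\,\|\,\mathsf{Split}(t)=\mathsf{Split}(t);\mathsf{Split}(t)\,\|\,\mathsf{Id}(t)$; (9) $\mathsf{Switch}(t,t'\cdot t'')=\mathsf{Switch}(t,t')\,\|\,\mathsf{Id}(t'');\mathsf{Id}(t')\,\|\,\mathsf{Switch}(t,t'')$; (10) $\mathsf{Sink}(t\cdot t')=\mathsf{Sink}(t)\,\|\,\mathsf{Sink}(t')$; (11) $\mathsf{Split}(t\cdot t')=\mathsf{Split}(t)\,\|\,\mathsf{Split}(t');\mathsf{Id}(t)\,\|\,\mathsf{Switch}(t,t')\,\|\,\mathsf{Id}(t')$; (12) if $S:s\to s'$, $T:t\to t'$ then $\mathsf{Switch}(s,t);T\,\|\,S;\mathsf{Switch}(t',s')=S\,\|\,T$; (13) $\mathsf{feedback}(\mathsf{Switch}(a,a))=\mathsf{Id}(a)$; (14) if $S:a\cdot s\to a\cdot t$ then $\mathsf{feedback}(S\,\|\,T)=\mathsf{feedback}(S)\,\|\,T$; (15) if $S:a\cdot s\to a\cdot t$, $A:s'\to s$, $B:t\to t'$ then $\mathsf{feedback}(\mathsf{Id}(a)\,\|\,A;S;\mathsf{Id}(a)\,\|\,B)=A;\mathsf{feedback}(S);B$;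 (16) if $S:a\cdot b\cdot s\to a\cdot b\cdot t$ then $\mathsf{feedback}^2(\mathsf{Switch}(b,a)\,\|\,\mathsf{Id}(s);S;\mathsf{Switch}(a,b)\,\|\,\mathsf{Id}(t))=\mathsf{feedback}^2(S)$.
   Context: Lists of types are written with $\cdot$ for concatenation and $\epsilon$ for the empty list. For a set $A$, $A^\bot=A\cup\{\bot\}$ with $\bot$ a fresh element, ordered by $a\le b\iff(a=\bot\lor a=b)$; this order is extended componentwise to products $A_1^\bot\times\cdots\times A_n^\bot$. A constructive function $f:A_1\cdots A_n\stackrel{c}{\longrightarrow}B_1\cdots B_m$ is a monotone function $f:A_1^\bot\times\cdots\times A_n^\bot\to B_1^\bot\times\cdots\times B_m^\bot$. Such monotone self-maps on these pointed cpos have least fixpoints. *)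

(* Defs.v *)
From Stdlib Require Import ClassicalEpsilon.
From mathcomp Require Import all_boot.

Set Implicit Arguments.
Unset Strict Implicit.
Unset Printing Implicit Defensive.

(* A type is an arbitrary set, with no decidability assumption; the orders    *)
(* below are therefore Prop-valued rather than instances of porderType.       *)
Definition ty := Type.

Definition monotone (X Y : Type) (leX : X -> X -> Prop) (leY : Y -> Y -> Prop)
    (f : X -> Y) : Prop :=
  forall x y, leX x y -> leY (f x) (f y).

Definition is_lfp (X : Type) (le : X -> X -> Prop) (f : X -> X) (x : X) : Prop :=
  f x = x /\ forall y, f y = y -> le x y.

(* A^bot is [option A], with bot = None.                                      *)
Definition flat_le (A : Type) (x y : option A) : Prop := x = None \/ x = y.

(* mu f is the least fixpoint of f when there is one, which is the case for   *)
(* every monotone f (lemma muP); otherwise it is unspecified.                 *)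
Definition mu (A : Type) (f : option A -> option A) : option A :=
  epsilon (inhabits None) (is_lfp (@flat_le A) f).

(* A1^bot * ... * An^bot                                                      *)
Fixpoint tup (t : seq ty) : Type :=
  if t is A :: t' then (option A * tup t')%type else unit.

Fixpoint tup_le (t : seq ty) : tup t -> tup t -> Prop :=
  if t is A :: t' then
    fun x y => flat_le x.1 y.1 /\ tup_le x.2 y.2
  else fun _ _ => True.

(* tcat, tfst and tsnd realize the identification of tup (s ++ t) with        *)
(* tup s * tup t.                                                             *)
Fixpoint tcat (s t : seq ty) : tup s -> tup t -> tup (s ++ t) :=
  if s is A :: s' then fun x y => (x.1, tcat x.2 y) else fun _ y => y.

Fixpoint tfst (s t : seq ty) : tup (s ++ t) -> tup s :=
  if s is A :: s' then fun z => (z.1, tfst z.2) else fun _ => tt.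

Fixpoint tsnd (s t : seq ty) : tup (s ++ t) -> tup t :=
  if s is A :: s' then fun z => tsnd z.2 else fun z => z.

Lemma tcatK1 s t (x : tup s) (y : tup t) : tfst (tcat x y) = x.
Proof. by elim: s x => [[]|A s IH [a x]] //=; rewrite IH. Qed.

Lemma tcatK2 s t (x : tup s) (y : tup t) : tsnd (tcat x y) = y.
Proof. by elim: s x => [|A s IH [a x]] //=. Qed.

Lemma tcat_fst_snd s t (z : tup (s ++ t)) : tcat (tfst z) (tsnd z) = z.
Proof. by elim: s z => [|A s IH [a z]] //=; rewrite IH. Qed.

Record diag (s t : seq ty) : Type := Diag {
  diag_fun :> tup s -> tup t;
  diag_mono : monotone (@tup_le s) (@tup_le t) diag_fun }.

Lemma flat_le_refl A (x : option A) : flat_le x x.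
Proof. by right. Qed.

Lemma tup_le_refl t (x : tup t) : tup_le x x.
Proof. by elim: t x => //= A t IH [a x]; split; [right | apply: IH]. Qed.

Lemma tcat_le s t (x x' : tup s) (y y' : tup t) :
  tup_le x x' -> tup_le y y' -> tup_le (tcat x y) (tcat x' y').
Proof.
by elim: s x x' => //= A s IH [a x] [a' x'] /= [? ?] ?; split=> //; apply: IH.
Qed.

Lemma tfst_le s t (z z' : tup (s ++ t)) :
  tup_le z z' -> tup_le (tfst z) (tfst z').
Proof.
by elim: s z z' => //= A s IH [a x] [a' x'] /= [? ?]; split=> //; apply: IH.
Qed.

Lemma tsnd_le s t (z z' : tup (s ++ t)) :
  tup_le z z' -> tup_le (tsnd z) (tsnd z').
Proof. by elim: s z z' => //= A s IH [a x] [a' x'] /= [? ?]; apply: IH. Qed.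

Lemma muP A (f : option A -> option A) :
  monotone (@flat_le A) (@flat_le A) f -> is_lfp (@flat_le A) f (mu f).
Proof.
move=> f_mono; apply: epsilon_spec; exists (f None); split.
  by case: (f_mono None (f None) (or_introl erefl)) => [E | <-] //; rewrite !E.
by move=> y <-; apply: f_mono; left.
Qed.

Lemma mu_le A (f g : option A -> option A) :
    monotone (@flat_le A) (@flat_le A) f ->
    monotone (@flat_le A) (@flat_le A) g ->
    (forall x, flat_le (f x) (g x)) ->
  flat_le (mu f) (mu g).
Proof.
move=> f_mono g_mono le_fg.
have [_ f_least] := muP f_mono; have [g_fix _] := muP g_mono.
case: (le_fg (mu g)) => Efg; last by apply: f_least; rewrite Efg g_fix.
left; case: (f_mono None (mu g) (or_introl erefl)) => Ef.
  by case: (f_least _ Ef).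
by rewrite Efg in Ef; case: (f_least _ Ef).
Qed.

Lemma diag_fst_mono a s t (f : diag (a :: s) (a :: t)) (y : tup s) :
  monotone (@flat_le a) (@flat_le a) (fun x => (f (x, y)).1).
Proof.
by move=> x x' le_x; case: (@diag_mono _ _ f (x, y) (x', y)) => //=; split=> //;
  apply: tup_le_refl.
Qed.

Lemma id_subproof t : monotone (@tup_le t) (@tup_le t) id.
Proof. by []. Qed.

Lemma split_subproof t :
  monotone (@tup_le t) (@tup_le (t ++ t)) (fun x => tcat x x).
Proof. by move=> x y le_xy; apply: tcat_le. Qed.

Lemma sink_subproof t : monotone (@tup_le t) (@tup_le [::]) (fun=> tt).
Proof. by []. Qed.

Lemma switch_subproof t t' :
  monotone (@tup_le (t ++ t')) (@tup_le (t' ++ t))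
    (fun z => tcat (tsnd z) (tfst z)).
Proof.
by move=> x y le_xy; apply: tcat_le; [apply: tsnd_le | apply: tfst_le].
Qed.

Lemma serial_subproof r s t (S : diag r s) (T : diag s t) :
  monotone (@tup_le r) (@tup_le t) (fun x => T (S x)).
Proof. by move=> x y le_xy; do 2! apply: diag_mono. Qed.

Lemma par_subproof s s' t t' (S : diag s s') (T : diag t t') :
  monotone (@tup_le (s ++ t)) (@tup_le (s' ++ t'))
    (fun z => tcat (S (tfst z)) (T (tsnd z))).
Proof.
move=> x y le_xy; apply: tcat_le; apply: diag_mono;
  [exact: tfst_le | exact: tsnd_le].
Qed.

Lemma feedback_subproof (a : ty) s t (f : diag (a :: s) (a :: t)) :
  monotone (@tup_le s) (@tup_le t)
    (fun y => (f (mu (fun x => (f (x, y)).1), y)).2).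
Proof.
move=> y y' le_y.
have le_f x x' : flat_le x x' -> tup_le (f (x, y)) (f (x', y')).
  by move=> le_x; apply: diag_mono.
have /le_f[] // : flat_le (mu (fun x => (f (x, y)).1)) (mu (fun x => (f (x, y')).1)).
apply: mu_le; try exact: diag_fst_mono.
by move=> x; case: (le_f x x (flat_le_refl x)).
Qed.

Definition dId t : diag t t := Diag (@id_subproof t).
Definition dSplit t : diag t (t ++ t) := Diag (@split_subproof t).
Definition dSink t : diag t [::] := Diag (@sink_subproof t).
Definition dSwitch t t' : diag (t ++ t') (t' ++ t) :=
  Diag (@switch_subproof t t').
Definition serial r s t (S : diag r s) (T : diag s t) : diag r t :=
  Diag (serial_subproof S T).
Definition par s s' t t' (S : diag s s') (T : diag t t') :
    diag (s ++ t) (s' ++ t') :=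
  Diag (par_subproof S T).
Definition feedback (a : ty) s t (f : diag (a :: s) (a :: t)) : diag s t :=
  Diag (feedback_subproof f).

(* Concatenation is associative, and right-unital, only up to a propositional *)
(* equality of lists of types; recast transports a diagram along such         *)
(* equalities.                                                                *)
Definition recast s s' t t' (es : s = s') (et : t = t') (S : diag s t) :
    diag s' t' :=
  eq_rect t (diag s') (eq_rect s (diag^~ t) S s' es) t' et.

Lemma cat4A (q r s t : seq ty) : (q ++ (r ++ s)) ++ t = (q ++ r) ++ (s ++ t).
Proof. by rewrite !catA. Qed.

Declare Scope diag_scope.
Delimit Scope diag_scope with diag.
Bind Scope diag_scope with diag.

Notation "S ;; T" := (serial S T) (at level 59, left associativity) : diag_scope.
Notation "S || T" := (par S T) : diag_scope.

(* Main.v *)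
From Stdlib Require Import Classical_Prop FunctionalExtensionality.
Require Import Defs.
From mathcomp Require Import all_boot.

Set Implicit Arguments.
Unset Strict Implicit.
Unset Printing Implicit Defensive.

(** Each axiom is an equation of tuple functions. Only (13)-(16) involve
    feedback, and only (16) needs an argument: by Bekic's lemma, the two orders
    of nesting of [mu] both compute the least fixpoint of the same pair of
    functions. *)

(** The monotonicity field is a proposition, so proof irrelevance leaves only the underlying
    functions to compare. *)
Lemma diag_ext s t (S T : diag s t) : (forall x, S x = T x) -> S = T.
Proof.
case: S T => [f f_mono] [g g_mono] /= /functional_extensionality eq_fg.
by case: _ / eq_fg g_mono => g_mono; rewrite (proof_irrelevance _ f_mono g_mono).
Qed.

(** The counterpart of [recast] on tuples: recasting a diagram amounts to composing it with such
    transports on both sides. *)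
Definition tcast s t (e : s = t) : tup s -> tup t :=
  fun x => eq_rect s tup x t e.

Lemma recastE s s' t t' (es : s = s') (et : t = t') (S : diag s t) x :
  recast es et S x = tcast et (S (tcast (esym es) x)).
Proof. by case: _ / es x; case: _ / et. Qed.

Lemma tcastKV s t (e : s = t) (x : tup t) : tcast e (tcast (esym e) x) = x.
Proof. by case: _ / e x. Qed.

Lemma tcast_id s (e : s = s) (x : tup s) : tcast e x = x.
Proof. by rewrite (proof_irrelevance _ e erefl). Qed.

(** Peels off the head in the inductions on lists below; any proof [e'] of the tail equality serves,
    by proof irrelevance. *)
Lemma tcast_cons A s t (e : A :: s = A :: t) (e' : s = t) (x : tup (A :: s)) :
  tcast e x = (x.1, tcast e' x.2).
Proof. by case: _ / e' e => e; rewrite tcast_id; case: x. Qed.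

Lemma tcast_catA r s t (e : r ++ s ++ t = (r ++ s) ++ t)
    (x : tup r) (y : tup s) (z : tup t) :
  tcast e (tcat x (tcat y z)) = tcat (tcat x y) z.
Proof.
elim: r x e => [|A r IH] x e /=; first by rewrite tcast_id.
by rewrite (tcast_cons e (catA r s t)) /= IH.
Qed.

Lemma tcast_catAV r s t (e : (r ++ s) ++ t = r ++ s ++ t)
    (x : tup r) (y : tup s) (z : tup t) :
  tcast e (tcat (tcat x y) z) = tcat x (tcat y z).
Proof. by rewrite -(tcast_catA (esym e)) tcastKV. Qed.

Lemma tcast_cats0 s (e : s ++ [::] = s) (x : tup s) (y : tup [::]) :
  tcast e (tcat x y) = x.
Proof.
elim: s x e => [|A s IH] [] => [|a x] e /=; first by rewrite tcast_id; case: y.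
by rewrite (tcast_cons e (cats0 s)) IH.
Qed.

Lemma tcast_cat4A q r s t (e : (q ++ (r ++ s)) ++ t = (q ++ r) ++ (s ++ t))
    (x : tup q) (y : tup r) (z : tup s) (w : tup t) :
  tcast e (tcat (tcat x (tcat y z)) w) = tcat (tcat x y) (tcat z w).
Proof.
elim: q x e => [|A q IH] x e /=; first by rewrite tcast_catAV.
by rewrite (tcast_cons e (cat4A q r s t)) /= IH.
Qed.

Lemma tcast_cat4AV q r s t (e : (q ++ r) ++ (s ++ t) = (q ++ (r ++ s)) ++ t)
    (x : tup q) (y : tup r) (z : tup s) (w : tup t) :
  tcast e (tcat (tcat x y) (tcat z w)) = tcat (tcat x (tcat y z)) w.
Proof. by rewrite -(tcast_cat4A (esym e)) tcastKV. Qed.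

(** Turns a variable input into an explicit concatenation, on which projections and transports
    simplify. *)
Lemma tcatP s t (P : tup (s ++ t) -> Prop) :
  (forall x y, P (tcat x y)) -> forall z, P z.
Proof. by move=> P_cat z; rewrite -(tcat_fst_snd z). Qed.

(** With the input cast moved to the side of [T], the variable [x] can be split along the bracketing
    used by [S]. *)
Lemma recast_ext s s' t t' (es : s = s') (et : t = t')
    (S : diag s t) (T : diag s' t') :
  (forall x, tcast et (S x) = T (tcast es x)) -> recast es et S = T.
Proof. by move=> eqST; apply: diag_ext => x; rewrite recastE eqST tcastKV. Qed.

Lemma flat_le_trans A (x y z : option A) :
  flat_le x y -> flat_le y z -> flat_le x z.
Proof. by move=> [->|->] // _; left. Qed.

Lemma flat_le_anti A (x y : option A) : flat_le x y -> flat_le y x -> x = y.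
Proof. by move=> [->|->] // [->|->]. Qed.

(** The flat order leaves two cases: either [x] is a fixpoint, or [f x] is bottom and monotonicity
    makes bottom itself a fixpoint. *)
Lemma mu_pre A (f : option A -> option A) x :
  monotone (@flat_le A) (@flat_le A) f -> flat_le (f x) x -> flat_le (mu f) x.
Proof.
move=> f_mono le_fx; have [_ f_least] := muP f_mono.
case: le_fx => [fx|]; last exact: f_least.
have fN : f None = None.
  by case: (f_mono None x (or_introl erefl)) => // ->.
by case: (f_least _ fN) => ->; left.
Qed.

Lemma mu_const A (x : option A) : mu (fun=> x) = x.
Proof. by have [<-] := muP (fun _ _ _ => flat_le_refl x). Qed.

Definition pair_le A B (p q : option A * option B) :=
  flat_le p.1 q.1 /\ flat_le p.2 q.2.

Section Bekic.
Variables (A B : Type).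
Variables (f : option A -> option B -> option A).
Variables (g : option A -> option B -> option B).
Hypothesis f_mono :
  monotone (@pair_le A B) (@flat_le A) (fun p => f p.1 p.2).
Hypothesis g_mono :
  monotone (@pair_le A B) (@flat_le B) (fun p => g p.1 p.2).

Let f_monol b : monotone (@flat_le A) (@flat_le A) (f^~ b).
Proof.
by move=> x x' le_x; apply: (f_mono (x := (x, b)) (y := (x', b))); split=> //; right.
Qed.

Let mu_f_mono : monotone (@flat_le B) (@flat_le A) (fun b => mu (f^~ b)).
Proof.
move=> b b' le_b; apply: mu_le => // x.
by apply: (f_mono (x := (x, b)) (y := (x, b'))); split=> //; right.
Qed.

Lemma bekic :
  let b := mu (fun b => g (mu (f^~ b)) b) in
  is_lfp (@pair_le A B) (fun p => (f p.1 p.2, g p.1 p.2)) (mu (f^~ b), b).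
Proof.
move=> b; pose h b' := g (mu (f^~ b')) b'.
have h_mono : monotone (@flat_le B) (@flat_le B) h.
  move=> x x' le_x.
  by apply: (g_mono (x := (_, x)) (y := (_, x'))); split=> //; apply: mu_f_mono.
have [fa _] := muP (f_monol b); have [hb _] := muP h_mono.
split; first by congr pair.
move=> [p q] [fp gq].
have le_p : flat_le (mu (f^~ q)) p by apply: mu_pre; rewrite // fp; right.
(* Here [q] is only known to be a prefixed point of [h]: [h q = g (mu (f^~ q)) q] lies below
   [g p q = q] by [le_p]. *)
have le_q : flat_le b q.
  apply: mu_pre => //; rewrite -[X in flat_le _ X]gq.
  by apply: (g_mono (x := (mu (f^~ q), q)) (y := (p, q))); split=> //; right.
by split=> //=; apply: flat_le_trans le_p; apply: mu_f_mono.
Qed.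

End Bekic.

(** The outer fixpoints [a] and [b] come from opposite nestings. Up to exchanging components,
    [bekic] makes both completed pairs least fixpoints of the same map, so each lies below the other
    and antisymmetry applies. *)
Lemma bekic_swap A B (f : option A -> option B -> option A)
    (g : option A -> option B -> option B)
    (a := mu (fun a => f a (mu (g a)))) (b := mu (fun b => g (mu (f^~ b)) b)) :
  monotone (@pair_le A B) (@flat_le A) (fun p => f p.1 p.2) ->
  monotone (@pair_le A B) (@flat_le B) (fun p => g p.1 p.2) ->
  mu (f^~ b) = a /\ mu (g a) = b.
Proof.
move=> f_mono g_mono.
have [[f1 g1] least1] := bekic f_mono g_mono.
have [||[g2 f2] least2] := @bekic _ _ (fun y x => g x y) (fun y x => f x y).
- by move=> [y x] [y' x'] [? ?]; apply: (g_mono (_, _) (_, _)).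
- by move=> [y x] [y' x'] [? ?]; apply: (f_mono (_, _) (_, _)).
have [le_a le_b] := least1 (a, mu (g a)) (congr2 pair f2 g2).
have [ge_b ge_a] := least2 (b, mu (f^~ b)) (congr2 pair g1 f1).
by split; apply: flat_le_anti.
Qed.

Local Open Scope diag_scope.

Theorem theorem1 :
  (* (1) *)
  (forall (t t' : seq ty) (S : diag t t'),
     dId t ;; S = S /\ S ;; dId t' = S) /\
  (* (2) *)
  (forall (t1 t2 t3 t4 : seq ty)
     (S : diag t1 t2) (T : diag t2 t3) (R : diag t3 t4),
     S ;; (T ;; R) = (S ;; T) ;; R) /\
  (* (3) *)
  (forall (t t' : seq ty) (S : diag t t'),
     dId [::] || S = S /\
     recast (cats0 t) (cats0 t') (S || dId [::]) = S) /\
  (* (4) *)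
  (forall (s s' t t' r r' : seq ty)
     (S : diag s s') (T : diag t t') (R : diag r r'),
     recast (catA s t r) (catA s' t' r') (S || (T || R)) = (S || T) || R) /\
  (* (5) *)
  (forall (s s' s'' t t' t'' : seq ty)
     (S : diag s s') (S' : diag s' s'') (T : diag t t') (T' : diag t' t''),
     (S || T) ;; (S' || T') = (S ;; S') || (T ;; T')) /\
  (* (6) *)
  (forall t : seq ty, dSplit t ;; dSink t || dId t = dId t) /\
  (* (7) *)
  (forall t : seq ty, dSplit t ;; dSwitch t t = dSplit t) /\
  (* (8) *)
  (forall t : seq ty,
     recast erefl (catA t t t) (dSplit t ;; dId t || dSplit t)
     = dSplit t ;; dSplit t || dId t) /\
  (* (9) *)
  (forall t t' t'' : seq ty,
     dSwitch t (t' ++ t'')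
     = recast (esym (catA t t' t'')) (esym (catA t' t t''))
         (dSwitch t t' || dId t'') ;;
       recast erefl (catA t' t'' t) (dId t' || dSwitch t t'')) /\
  (* (10) *)
  (forall t t' : seq ty, dSink (t ++ t') = dSink t || dSink t') /\
  (* (11) *)
  (forall t t' : seq ty,
     dSplit (t ++ t')
     = dSplit t || dSplit t' ;;
       recast (cat4A t t t' t') (cat4A t t' t t')
         (dId t || dSwitch t t' || dId t')) /\
  (* (12) *)
  (forall (s s' t t' : seq ty) (S : diag s s') (T : diag t t'),
     dSwitch s t ;; T || S ;; dSwitch t' s' = S || T) /\
  (* (13) *)
  (forall a : ty, feedback (dSwitch [:: a] [:: a]) = dId [:: a]) /\
  (* (14) *)
  (forall (a : ty) (s t s' t' : seq ty)
     (S : diag (a :: s) (a :: t)) (T : diag s' t'),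
     feedback (S || T : diag (a :: (s ++ s')) (a :: (t ++ t')))
     = feedback S || T) /\
  (* (15) *)
  (forall (a : ty) (s t s' t' : seq ty)
     (S : diag (a :: s) (a :: t)) (A : diag s' s) (B : diag t t'),
     feedback (dId [:: a] || A ;; S ;; dId [:: a] || B)
     = A ;; feedback S ;; B) /\
  (* (16) *)
  (forall (a b : ty) (s t : seq ty)
     (S : diag [:: a, b & s] [:: a, b & t]),
     feedback (feedback
       (dSwitch [:: b] [:: a] || dId s ;; S ;; dSwitch [:: a] [:: b] || dId t))
     = feedback (feedback S)).
Proof.
split; first by move=> t t' S; split; apply: diag_ext.
split; first by move=> *; apply: diag_ext.
split.
  move=> t t' S; split; first exact: diag_ext.
  apply: recast_ext; apply: tcatP => x y.
  by rewrite /= !tcast_cats0 tcatK1.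
split.
  move=> s s' t t' r r' S T R; apply: recast_ext.
  apply: tcatP => x; apply: tcatP => y z.
  by rewrite /= !(tcast_catA, tcatK1, tcatK2).
split; first by move=> *; apply: diag_ext => x; rewrite /= !(tcatK1, tcatK2).
split; first by move=> t; apply: diag_ext => x; rewrite /= tcatK2.
split; first by move=> t; apply: diag_ext => x; rewrite /= tcatK1 tcatK2.
split.
  move=> t; apply: recast_ext => x.
  by rewrite /= !(tcast_catA, tcatK1, tcatK2).
split.
  move=> t t' t''; apply: diag_ext.
  apply: tcatP => x; apply: tcatP => y z.
  by rewrite /= !recastE /= !(tcast_catA, tcast_catAV, tcatK1, tcatK2).
split; first by move=> *; apply: diag_ext.
split.
  move=> t t'; apply: diag_ext; apply: tcatP => x y.
  by rewrite /= recastE /= !(tcast_cat4A, tcast_cat4AV, tcatK1, tcatK2).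
split; first by move=> *; apply: diag_ext => x; rewrite /= !(tcatK1, tcatK2).
split.
  (* The swap feeds back the external input, so the iterated function is constant. *)
  by move=> a; apply: diag_ext => -[x []]; rewrite /= mu_const.
(* Axioms (14) and (15) hold by conversion: the fed-back wire is the head of the list, so [tcat],
   [tfst] and [tsnd] reduce on it. *)
split; first by move=> *; apply: diag_ext.
split; first by move=> *; apply: diag_ext.
move=> a b s t S; apply: diag_ext => y /=.
(* With the input [y] fixed, these are the outputs of [S] on its two feedback wires. The left side
   closes the second wire first, the right side the first wire first. *)
pose f x z := (S (x, (z, y))).1; pose g x z := (S (x, (z, y))).2.1.
have S_mono p q : pair_le p q ->
    tup_le (S (p.1, (p.2, y))) (S (q.1, (q.2, y))).
  by move=> [? ?]; apply: diag_mono; do 2!split=> //; apply: tup_le_refl.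
have [||Ea Eb] := @bekic_swap _ _ f g.
- by move=> p q /S_mono[].
- by move=> p q /S_mono[? []].
by rewrite /f /g in Ea Eb; rewrite Ea Eb.
Qed.
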